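(* Let $d\ge 1$, let $p\ge 2$ be an even integer and let $f\in L^p[0,1]^d$ be real-valued. Then $\underline{\tau}_u^{(p)}\le \underline{\tau}_v^{(p)}$ holds whenever $u\subseteq v\subseteq\{1,\dots,d\}$.
   Context: Let $\mathcal{D}=\{1,2,\dots,d\}$ and $\mu=\int_{[0,1]^d}f(\boldsymbol{x})\,\mathrm{d}\boldsymbol{x}$. For $u\subseteq\mathcal{D}$ and $\boldsymbol{x},\boldsymbol{z}\in[0,1]^d$, $\boldsymbol{x}_u{:}\boldsymbol{z}_{-u}$ denotes the point $\boldsymbol{y}\in[0,1]^d$ with $y_j=x_j$ for $j\in u$ and $y_j=z_j$ for $j\notin u$. For $u\subseteq\mathcal{D}$, the quantity $\underline{\tau}_u^{(p)}$ is defined by $$\underline{\tau}^{(p)}_u+\mu^p=\int_{[0,1]^{d}}\int_{[0,1]^d}\cdots\int_{[0,1]^d}\ \prod_{k=1}^p f(\boldsymbol{x}_u{:}\boldsymbol{z}^{(k)}_{-u})\,\mathrm{d}\boldsymbol{x}\prod_{k=1}^p\mathrm{d}\boldsymbol{z}^{(k)},$$ where $\boldsymbol{x},\boldsymbol{z}^{(1)},\dots,\boldsymbol{z}^{(p)}\in[0,1]^d$. *)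

(* Defs.v *)
From HB Require Import structures.
From mathcomp Require Import all_boot all_order all_algebra.
From mathcomp Require Import all_classical all_reals all_analysis.

Set Implicit Arguments.
Unset Strict Implicit.
Unset Printing Implicit Defensive.

Import Order.TTheory GRing.Theory Num.Theory.
Import numFieldNormedType.Exports.

Local Open Scope classical_set_scope.
Local Open Scope ring_scope.

(* The [n]-fold product of a sigma-finite measure [m], as a measure on
   [n.-tuple T]: the Dirac mass at the empty tuple for [n = 0], then the image
   of [m \x m^n] under [(x, t) |-> x :: t]. *)
Section tuple_measure.
Context {d : measure_display} {T : measurableType d} {R : realType}.

Definition tuple_cons n (xt : T * n.-tuple T) : n.+1.-tuple T :=
  [tuple of xt.1 :: xt.2].

Lemma measurable_tuple_cons n : measurable_fun setT (@tuple_cons n).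
Proof. exact: measurable_cons measurable_fst measurable_snd. Qed.

Section step.
Variables (m : {sigma_finite_measure set T -> \bar R}) (n : nat).
Variable P : {sigma_finite_measure set (n.-tuple T) -> \bar R}.
Local Open Scope ereal_scope.

Definition tuple_measure_step : set (n.+1.-tuple T) -> \bar R :=
  pushforward (m \x P) (@tuple_cons n).

Let step0 : tuple_measure_step set0 = 0.
Proof. by rewrite /tuple_measure_step /pushforward preimage_set0 measure0. Qed.

Let step_ge0 A : 0 <= tuple_measure_step A.
Proof. by rewrite /tuple_measure_step /pushforward measure_ge0. Qed.

Let step_sigma_additive : semi_sigma_additive tuple_measure_step.
Proof.
pose f : {mfun _ >-> _} :=
  HB.pack (@tuple_cons n)
    (isMeasurableFun.Build _ _ _ _ _ (@measurable_tuple_cons n)).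
exact: (@measure_semi_sigma_additive _ _ _ (pushforward (m \x P) f)).
Qed.

HB.instance Definition _ := isMeasure.Build _ _ _ tuple_measure_step
  step0 step_ge0 step_sigma_additive.

Let step_sigma_finite : sigma_finite setT tuple_measure_step.
Proof.
have /sigma_finiteP[F [FT ndF mF]] := sigma_finiteT m.
have /sigma_finiteP[G [GT ndG mG]] := sigma_finiteT P.
exists (fun i => [set t : n.+1.-tuple T | F i (tnth t ord0) /\
                   G i [tuple of behead t]]).
  apply/seteqP; split=> // t _.
  have [i _ Fi] : (\bigcup_i F i) (tnth t ord0) by rewrite -FT.
  have [j _ Gj] : (\bigcup_i G i) [tuple of behead t] by rewrite -GT.
  exists (maxn i j) => //; split.
    exact: (subsetPset _ _ (ndF _ _ (leq_maxl i j))).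
  exact: (subsetPset _ _ (ndG _ _ (leq_maxr i j))).
move=> i; have [mFi Fioo] := mF i; have [mGi Gioo] := mG i; split.
  apply: measurableI.
    by rewrite -[X in measurable X]setTI; exact: measurable_tnth.
  by rewrite -[X in measurable X]setTI; exact: measurable_behead.
rewrite /tuple_measure_step /pushforward.
rewrite (_ : _ @^-1` _ = F i `*` G i); last first.
  have tE x (t : n.-tuple T) : [tuple of behead (tuple_cons (x, t))] = t.
    exact/val_inj.
  by apply/seteqP; split=> -[x t] [/= ? ?]; split=> //; [rewrite -(tE x t)|
    rewrite /= tE].
by rewrite product_measure1E// lte_mul_pinfty// ge0_fin_numE.
Qed.

HB.instance Definition _ :=
  Measure_isSigmaFinite.Build _ _ _ tuple_measure_step step_sigma_finite.

End step.

Fixpoint tuple_measure (m : {sigma_finite_measure set T -> \bar R}) (n : nat)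
    : {sigma_finite_measure set (n.-tuple T) -> \bar R} :=
  match n with
  | 0 => @dirac _ (0.-tuple T) [tuple] R
  | k.+1 => tuple_measure_step m (tuple_measure m k)
  end.

Lemma tuple_measure_box (m : {sigma_finite_measure set T -> \bar R}) n
    (A : 'I_n -> set T) : (forall i, measurable (A i)) ->
  tuple_measure m n [set t | forall i, A i (tnth t i)] =
  (\prod_(i < n) m (A i))%E.
Proof.
elim: n A => [|n IHn] A mA.
  by rewrite big_ord0 /= diracE mem_set//= => -[].
rewrite big_ord_recl /= /tuple_measure_step /pushforward.
rewrite (_ : _ @^-1` _ = A ord0 `*`
    [set t : n.-tuple T | forall i, A (lift ord0 i) (tnth t i)]); last first.
  apply/seteqP; split=> -[x t]/=.
    move=> h; split=> [|i]; first exact: (h ord0).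
    by have := h (lift ord0 i); rewrite tnthS.
  move=> [hx ht] i; case: (unliftP ord0 i) => [j ->|->//].
  by rewrite tnthS.
rewrite product_measure1E//.
  by congr *%E; exact: (IHn (fun i => A (lift ord0 i))).
rewrite (_ : mkset _ = \bigcap_i ((@tnth n T) ^~ i @^-1` A (lift ord0 i)));
    last first.
  by apply/seteqP; split=> t /= h i; [move=> _|]; exact: h.
apply: fin_bigcap_measurable => // i _.
by rewrite -[X in measurable X]setTI; exact: measurable_tnth.
Qed.

End tuple_measure.

Section sensitivity.
Context {R : realType}.
Variable d : nat.

Local Notation Rd := (d.-tuple (measurableTypeR R)).

Definition lebesgue_tuple : {sigma_finite_measure set Rd -> \bar R} :=
  tuple_measure (@lebesgue_measure R) d.

Definition cube : set Rd := [set x | forall j : 'I_d, 0 <= tnth x j <= 1].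

(* The point [x_u : z_{-u}]. *)
Definition hybrid (u : {set 'I_d}) (x z : Rd) : Rd :=
  [tuple if j \in u then tnth x j else tnth z j | j < d].

Definition mean (f : Rd -> R) : R := \int[lebesgue_tuple]_(x in cube) f x.

(* The integration variable is [w = (x, (z^(1), ..., z^(p)))], ranging over
   [[0,1]^d * ([0,1]^d)^p]. *)
Definition lower_tau (p : nat) (f : Rd -> R) (u : {set 'I_d}) : R :=
  (\int[(lebesgue_tuple \x tuple_measure lebesgue_tuple p)%E]_(w in
       cube `*` [set z : p.-tuple Rd | forall k, cube (tnth z k)])
     (\prod_(k < p) f (hybrid u w.1 (tnth w.2 k))))
  - (mean f) ^+ p.

End sensitivity.

Arguments cube {R} d.

(* Main.v *)
From HB Require Import structures.
Require Import Defs.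
From mathcomp Require Import all_boot all_order all_algebra.
From mathcomp Require Import all_classical all_reals all_analysis.
From mathcomp Require Import measurable_realfun ring lra.

Set Implicit Arguments.
Unset Strict Implicit.
Unset Printing Implicit Defensive.

Import Order.TTheory GRing.Theory Num.Theory.
Import numFieldNormedType.Exports.

Local Open Scope classical_set_scope.
Local Open Scope ring_scope.

(** Write E for the mean with respect to the uniform probability on the cube,
    x_u for the coordinates of x in u, and F_u(x) for the mean of
    f(x_u : z_(-u)) over z, which is the conditional mean E(f | x_u).

    For fixed x the p replicas z^(1), ..., z^(p) are independent, so the
    integral defining tau_u + mu^p is E(F_u^p) ([Rintegral_replicas]).  When u
    is contained in v, the tower property says that F_u = E(F_v | x_u), and
    Jensen's inequality for t |-> |t|^p ([jensen_exprn]) gives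
    |F_u|^p <= E(|F_v|^p | x_u) ([normrX_slice_mean_le]).  Taking means,
    E(|F_u|^p) <= E(|F_v|^p), and the absolute values disappear because p is
    even.

    Conditional means are handled through one fact: if x and z are independent
    with the uniform law, then so is x_u : z_(-u) ([hybrid_measure_preserving]).
    Together with the identity x_u : (y_v : z_(-v)) = (x_u : y_(-u))_v : z_(-v)
    for u contained in v ([hybridA]) it yields the tower property, the passage
    from E(E(|F_v|^p | x_u)) to E(|F_v|^p), and the integrability of the product
    of the p replicas, which is bounded by E(|f|^p).

    These steps hold for the d-fold power of any probability on the line.  The
    cube enters only through the remark that the Lebesgue measure on R^d
    restricted to the cube is the d-fold power of its restriction to [0, 1]
    ([tuple_restriction]); f is replaced by its extension by 0.  *)

(** * Jensen's inequality for powers *)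

(** The graph of s |-> s^(n+1) lies above its tangent at a.  The negative term
    of the tangent is moved to the right, so that both sides can be integrated
    as nonnegative functions. *)
Lemma exprn_tangent_le (R : realFieldType) n (a s : R) : 0 <= a -> 0 <= s ->
  n.+1%:R * a ^+ n * s <= s ^+ n.+1 + n%:R * a ^+ n.+1.
Proof.
move=> a0 s0; elim: n => [|n IHn]; first by rewrite expr0 expr1; lra.
have h1 := ler_wpM2l s0 IHn.
(* s times the induction hypothesis misses the goal by this square term *)
have h2 : 0 <= n.+1%:R * a ^+ n * (s - a) ^+ 2.
  by rewrite mulr_ge0 ?sqr_ge0// mulr_ge0// exprn_ge0.
rewrite -subr_ge0; rewrite -subr_ge0 in h1; apply: le_trans (addr_ge0 h1 h2) _.
rewrite le_eqVlt; apply/orP; left; apply/eqP.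
by rewrite !exprS -!natr1; ring.
Qed.

(** Integrate the tangent inequality at the mean of h.  The mean is finite as
    soon as the right-hand side is, by the same inequality at 1. *)
Lemma jensen_exprn (d : measure_display) (T : measurableType d)
    (R : realType) (m : {measure set T -> \bar R}) (h : T -> R) n :
  m setT = 1%E -> measurable_fun setT h -> (forall x, 0 <= h x) ->
  ((\int[m]_x (h x)%:E) ^+ n.+1 <= \int[m]_x (h x ^+ n.+1)%:E)%E.
Proof.
move=> m1 mh h0.
have mEh : measurable_fun setT (EFin \o h) by exact/measurable_EFinP.
have mEhn : measurable_fun setT (EFin \o (fun x => h x ^+ n.+1)).
  by apply/measurable_EFinP; exact: measurable_funX.
have hn0 x : (0 <= (h x ^+ n.+1)%:E)%E by rewrite lee_fin exprn_ge0.
have [->|Hn] := eqVneq (\int[m]_x (h x ^+ n.+1)%:E)%E +oo%E.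
  by rewrite leey.
have intc c : (\int[m]_x c%:E = c%:E)%E by rewrite integral_cst// m1 mule1.
have hfin : (\int[m]_x (h x)%:E)%E \is a fin_num.
  rewrite ge0_fin_numE; last by apply: integral_ge0 => x _; rewrite lee_fin.
  apply: (@le_lt_trans _ _ (\int[m]_x ((h x ^+ n.+1)%:E + n.+1%:R%:E))%E).
    apply: ge0_le_integral => //.
    - by move=> x _; rewrite lee_fin.
    - by apply: emeasurable_funD.
    - move=> x _; rewrite -EFinD lee_fin.
      have := exprn_tangent_le n ler01 (h0 x); rewrite !expr1n !mulr1 => H.
      have : h x <= n.+1%:R * h x by rewrite ler_peMl// ler1n.
      by rewrite -natr1; lra.
  rewrite ge0_integralD//.
  apply: lte_add_pinfty; first by rewrite lt_neqAle Hn leey.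
  by rewrite (intc n.+1%:R) ltry.
set a := fine (\int[m]_x (h x)%:E)%E.
have aE : (\int[m]_x (h x)%:E)%E = a%:E by rewrite /a fineK.
have a0 : 0 <= a.
  by rewrite /a fine_ge0//; apply: integral_ge0 => x _; rewrite lee_fin.
have H : (\int[m]_x ((n.+1%:R * a ^+ n)%:E * (h x)%:E) <=
    \int[m]_x ((h x ^+ n.+1)%:E + (n%:R * a ^+ n.+1)%:E))%E.
  apply: ge0_le_integral => //.
  - by move=> x _; rewrite -EFinM lee_fin !mulr_ge0// exprn_ge0.
  - by apply: emeasurable_funM.
  - by apply: emeasurable_funD.
  - by move=> x _; rewrite -EFinM -EFinD lee_fin exprn_tangent_le.
move: H; rewrite ge0_integralZl//; last 2 first.
- by move=> x _; rewrite lee_fin.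
- by rewrite lee_fin mulr_ge0// exprn_ge0.
rewrite ge0_integralD//; last first.
  by move=> x _; rewrite lee_fin mulr_ge0// exprn_ge0.
rewrite intc aE -EFin_expe.
case: (\int[m]_x (h x ^+ n.+1)%:E)%E Hn => [r _||]//.
by rewrite -EFinM -EFinD !lee_fin exprS -natr1; lra.
Qed.

(** * Real-valued integrals *)

(** The positive or the negative part has integral +oo, so the integral is
    infinite and its real part is 0.  This lets identities between real-valued
    integrals hold at every point, where one would expect them almost
    everywhere. *)
Lemma Rintegral_not_integrable (d : measure_display) (T : measurableType d)
    (R : realType) (m : {measure set T -> \bar R}) (h : T -> R) :
  measurable_fun setT h -> ~ m.-integrable setT (EFin \o h) ->
  \int[m]_x h x = 0.
Proof.
move=> mh nih; rewrite /Rintegral integralE.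
have : (\int[m]_x `|(h x)%:E| = +oo)%E.
  apply: contrapT => hoo; apply: nih; apply/integrableP; split.
    exact/measurable_EFinP.
  by rewrite lt_neqAle leey andbT; exact/eqP.
have mEh : measurable_fun setT (EFin \o h) by exact/measurable_EFinP.
under eq_integral do rewrite -/((abse \o (EFin \o h)) _) fune_abse.
rewrite ge0_integralD//; last 2 first.
- exact: measurable_funepos.
- exact: measurable_funeneg.
by case: (\int[m]_x _)%E => [r||]; case: (\int[m]_x _)%E => [s||].
Qed.

Lemma RintegralFubini (d1 d2 : measure_display) (T1 : measurableType d1)
    (T2 : measurableType d2) (R : realType)
    (m1 : {sigma_finite_measure set T1 -> \bar R})
    (m2 : {sigma_finite_measure set T2 -> \bar R}) (h : T1 * T2 -> R) :
  (m1 \x m2)%E.-integrable setT (EFin \o h) ->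
  \int[(m1 \x m2)%E]_w h w = \int[m1]_x \int[m2]_y h (x, y).
Proof.
move=> ih; rewrite /Rintegral -integral12_prod_meas1//; congr fine.
have iF := integrable_fubini_F ih.
apply: ae_eq_integral => //.
- exact: measurable_int iF.
- apply/measurable_EFinP/measurableT_comp => //.
  exact: measurable_int iF.
- move: (integrable_ae measurableT iF); apply: filterS => x /= xfin _.
  by rewrite fineK//; exact: xfin.
Qed.

(** * Products over independent replicas *)

Section replicas.
Context (d : measure_display) (T : measurableType d) (R : realType).
Variable m : {sigma_finite_measure set T -> \bar R}.

Lemma measurable_prod_tnth n (h : T -> R) : measurable_fun setT h ->
  measurable_fun setT (fun z : n.-tuple T => \prod_(k < n) h (tnth z k)).
Proof.
move=> mh; apply: measurable_prod => k _.
by apply: measurableT_comp => //; exact: measurable_tnth.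
Qed.

Lemma measurable_fst_prod_snd n (h : T -> R) : measurable_fun setT h ->
  measurable_fun setT
    (fun w : T * n.-tuple T => h w.1 * \prod_(k < n) h (tnth w.2 k)).
Proof.
move=> mh; apply: measurable_funM.
  exact: (measurableT_comp mh measurable_fst).
apply: measurable_prod => k _.
apply: (measurableT_comp mh).
exact: (measurableT_comp (measurable_tnth k) measurable_snd).
Qed.

Lemma prod_tuple_cons n (h : T -> R) (w : T * n.-tuple T) :
  \prod_(k < n.+1) h (tnth (tuple_cons w) k) =
  h w.1 * \prod_(k < n) h (tnth w.2 k).
Proof.
rewrite big_ord_recl; congr (_ * _).
by apply: eq_bigr => k _; rewrite tnthS.
Qed.

Lemma integral_prod_tnth0 (h : T -> R) :
  (\int[tuple_measure m 0]_z (\prod_(k < 0) h (tnth z k))%:E = 1)%E.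
Proof.
under eq_integral do rewrite big_ord0.
by rewrite integral_cst//= diracT mule1.
Qed.

Lemma ge0_integral_prod_tnth n (h : T -> R) : measurable_fun setT h ->
  (forall x, 0 <= h x) ->
  (\int[tuple_measure m n]_z (\prod_(k < n) h (tnth z k))%:E =
  (\int[m]_x (h x)%:E) ^+ n)%E.
Proof.
move=> mh h0; elim: n => [|n IHn].
  by rewrite integral_prod_tnth0.
have prod0 k (z : k.-tuple T) : 0 <= \prod_(i < k) h (tnth z i).
  by apply: prodr_ge0.
have mprod k : measurable_fun setT
    (EFin \o (fun z : k.-tuple T => \prod_(i < k) h (tnth z i))).
  by apply/measurable_EFinP; exact: measurable_prod_tnth.
rewrite [LHS]/= ge0_integral_pushforward//; last 3 first.
- exact: measurable_tuple_cons.
- exact: mprod.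
- by move=> z _; rewrite lee_fin prod0.
rewrite preimage_setT [LHS]/=.
under eq_integral do rewrite prod_tuple_cons.
rewrite fubini_tonelli1//; last 2 first.
- by apply/measurable_EFinP; exact: measurable_fst_prod_snd.
- by move=> w; rewrite lee_fin mulr_ge0.
rewrite /fubini_F expeS -IHn -ge0_integralZr//; last 3 first.
- exact/measurable_EFinP.
- by move=> x _; rewrite lee_fin.
- by apply: integral_ge0 => z _; rewrite lee_fin prod0.
apply: eq_integral => x _.
under eq_integral do rewrite /= EFinM.
rewrite ge0_integralZl ?lee_fin//; first exact: mprod.
by move=> z _; rewrite lee_fin prod0.
Qed.

Lemma integrable_prod_tnth n (h : T -> R) : m.-integrable setT (EFin \o h) ->
  (tuple_measure m n).-integrable setT
    (EFin \o (fun z : n.-tuple T => \prod_(k < n) h (tnth z k))).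
Proof.
move=> ih; have /integrableP[/measurable_EFinP mh hoo] := ih.
apply/integrableP; split.
  by apply/measurable_EFinP; exact: measurable_prod_tnth.
under eq_integral do rewrite /= normr_prod.
rewrite (ge0_integral_prod_tnth n (h := fun x => `|h x|))//;
    last exact: measurableT_comp.
elim: n => [|n IHn]; first by rewrite expe0 ltry.
by rewrite expeS lte_mul_pinfty// ?integral_ge0// ge0_fin_numE// integral_ge0.
Qed.

(** By Fubini if h is integrable.  If it is not and n > 0, then the absolute
    value of the product has integral (+oo)^n = +oo, so both sides are 0. *)
Lemma Rintegral_prod_tnth n (h : T -> R) : measurable_fun setT h ->
  \int[tuple_measure m n]_z (\prod_(k < n) h (tnth z k)) =
  (\int[m]_x h x) ^+ n.
Proof.
move=> mh.
have [ih|nih] := pselect (m.-integrable setT (EFin \o h)); last first.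
  case: n => [|n].
    by rewrite /Rintegral integral_prod_tnth0.
  rewrite (Rintegral_not_integrable mh)// expr0n Rintegral_not_integrable//.
    exact: measurable_prod_tnth.
  move=> /integrableP[_].
  under eq_integral do rewrite /= normr_prod.
  rewrite (ge0_integral_prod_tnth n.+1 (h := fun x => `|h x|))//;
    last exact: measurableT_comp.
  have -> : (\int[m]_x `|h x|%:E = +oo)%E.
    apply: contrapT => hoo; apply: nih; apply/integrableP; split.
      exact/measurable_EFinP.
    by rewrite lt_neqAle leey andbT; exact/eqP.
  suff -> : (+oo ^+ n.+1 = +oo :> \bar R)%E by rewrite ltxx.
  by elim: n => // n IHn; rewrite expeS IHn mulyy.
elim: n => [|n IHn].
  by rewrite /Rintegral integral_prod_tnth0.
have iP := integrable_prod_tnth n.+1 ih.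
have mprod := @measurable_prod_tnth n.+1 h mh.
have ic : (m \x tuple_measure m n)%E.-integrable setT
    (EFin \o (fun w => h w.1 * \prod_(k < n) h (tnth w.2 k))).
  apply/integrableP; split.
    by apply/measurable_EFinP; exact: measurable_fst_prod_snd.
  have /integrableP[_] := iP.
  rewrite /= ge0_integral_pushforward//; last 2 first.
  - exact: measurable_tuple_cons.
  - by do 2 apply: measurableT_comp => //.
  rewrite preimage_setT /=.
  by under eq_integral do rewrite prod_tuple_cons.
transitivity (\int[(m \x tuple_measure m n)%E]_w
    (h w.1 * \prod_(k < n) h (tnth w.2 k))).
  rewrite /Rintegral /= integral_pushforward//; last 3 first.
  - exact: measurable_tuple_cons.
  - exact/measurable_EFinP.
  - rewrite preimage_setT /=; move: ic; congr (_.-integrable _ _).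
    by apply/funext => w /=; rewrite prod_tuple_cons.
  rewrite preimage_setT /=; congr fine; apply: eq_integral => w _ /=.
  by rewrite prod_tuple_cons.
rewrite RintegralFubini// exprS -IHn -RintegralZr//.
apply: eq_Rintegral => x _; rewrite /= RintegralZl//.
exact: integrable_prod_tnth.
Qed.

End replicas.

Section replica_fubini.
Context (d1 d2 : measure_display) (S : measurableType d1)
  (T : measurableType d2) (R : realType).
Variables (M : {sigma_finite_measure set S -> \bar R})
  (m : {sigma_finite_measure set T -> \bar R}).

Lemma measurable_replicas n (H : S * T -> R) : measurable_fun setT H ->
  measurable_fun setT
    (fun w : S * n.-tuple T => \prod_(k < n) H (w.1, tnth w.2 k)).
Proof.
move=> mH; apply: measurable_prod => k _.
apply: (measurableT_comp mH); apply: measurable_fun_pair => //.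
exact: (measurableT_comp (measurable_tnth k) measurable_snd).
Qed.

(** By Tonelli, the hypothesis is the integrability of the product. *)
Lemma Rintegral_replicas n (H : S * T -> R) : measurable_fun setT H ->
  (\int[M]_x (\int[m]_y `|H (x, y)|%:E) ^+ n < +oo)%E ->
  \int[(M \x tuple_measure m n)%E]_w \prod_(k < n) H (w.1, tnth w.2 k) =
  \int[M]_x (\int[m]_y H (x, y)) ^+ n.
Proof.
move=> mH Hoo; have mHx x : measurable_fun setT (fun y => H (x, y)).
  exact: (measurable_fun_pair2 x mH).
rewrite RintegralFubini; last first.
  apply/integrable12ltyP.
    by apply/measurable_EFinP; exact: measurable_replicas.
  rewrite /=; under eq_integral => x _.
    under eq_integral do rewrite normr_prod.
    rewrite (@ge0_integral_prod_tnth _ _ _ m n (fun y => `|H (x, y)|))//;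
      last first.
      exact: measurableT_comp.
    over.
  exact: Hoo.
by apply: eq_Rintegral => x _; rewrite -Rintegral_prod_tnth.
Qed.

End replica_fubini.

(** * Uniqueness of the power of a probability *)

Section boxes.
Context (d : measure_display) (T : measurableType d) (R : realType).

Lemma measurable_box n (A : 'I_n -> set T) : (forall i, measurable (A i)) ->
  measurable [set t : n.-tuple T | forall i, A i (tnth t i)].
Proof.
move=> mA; rewrite (_ : mkset _ = \bigcap_i ((@tnth n T) ^~ i @^-1` A i)).
  apply: fin_bigcap_measurable => // i _.
  by rewrite -[X in measurable X]setTI; exact: measurable_tnth.
by apply/seteqP; split=> t /= h i; [move=> _|]; exact: h.
Qed.

(** Boxes form a pi-system which generates the sigma-algebra, the latter being
    generated by the coordinates. *)
Lemma tuple_measure_unique n (m : {sigma_finite_measure set T -> \bar R})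
    (m' : {measure set (n.-tuple T) -> \bar R}) :
  m setT = 1%E ->
  (forall A : 'I_n -> set T, (forall i, measurable (A i)) ->
    m' [set t | forall i, A i (tnth t i)] = (\prod_(i < n) m (A i))%E) ->
  forall X, measurable X -> m' X = tuple_measure m n X.
Proof.
move=> m1 m'E X mX.
pose G := [set B | exists2 A : 'I_n -> set T, (forall i, measurable (A i)) &
  B = [set t | forall i, A i (tnth t i)]].
have GT : G setT by exists (fun=> setT) => //; apply/seteqP.
apply: (measure_unique G (fun=> setT)) => //.
- apply/seteqP; split; last first.
    apply: smallest_sub; first exact: sigma_algebra_measurable.
    by move=> _ [A mA ->]; exact: measurable_box.
  apply: smallest_sub; first exact: smallest_sigma_algebra.
  elim/big_ind : _ => [//|A B sA sB C [/sA|/sB]//|].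
  move=> i _ _ [A mA <-]; apply: sub_sigma_algebra.
  exists (fun j => if j == i then A else setT) => [j|]; first by case: ifP.
  apply/seteqP; split => [t [_ At] j|t At]; first by case: eqP => // ->.
  by split => //; have := At i; rewrite eqxx.
- move=> _ _ [A mA ->] [B mB ->]; exists (fun i => A i `&` B i) => [i|].
    exact: measurableI.
  apply/seteqP; split => [t [At Bt] i|t ABt]; first by split.
  by split=> i; have [] := ABt i.
- by rewrite bigcup_const.
- move=> _ [A mA ->]; rewrite m'E//; exact/esym/tuple_measure_box.
- move=> _; have := m'E (fun=> setT) (fun=> measurableT).
  rewrite big1// (_ : mkset _ = setT); last exact/seteqP.
  by move=> ->; rewrite ltry.
Qed.

End boxes.

Lemma tuple_measure_setT (d : measure_display) (T : measurableType d)
    (R : realType) (m : {sigma_finite_measure set T -> \bar R}) n :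
  m setT = 1%E -> tuple_measure m n setT = 1%E.
Proof.
move=> m1.
have := @tuple_measure_box _ _ _ m n (fun=> setT) (fun=> measurableT).
by rewrite big1// (_ : mkset _ = setT)//; exact/seteqP.
Qed.

(** * The hybrid point of two independent points *)

Section hybrid.
Context {R : realType} {d : nat}.
Local Notation Rd := (d.-tuple (measurableTypeR R)).
Implicit Types (u v : {set 'I_d}) (x y z : Rd).

Lemma hybrid_setT x z : hybrid [set: 'I_d] x z = x.
Proof. by apply: eq_from_tnth => j; rewrite tnth_mktuple inE. Qed.

Lemma hybridA u v x y z : u \subset v ->
  hybrid u x (hybrid v y z) = hybrid v (hybrid u x y) z.
Proof.
move=> /fintype.subsetP uv; apply: eq_from_tnth => j; rewrite !tnth_mktuple.
by case: ifP => [/uv ->|].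
Qed.

Lemma measurable_hybrid u :
  measurable_fun setT (fun w : Rd * Rd => hybrid u w.1 w.2).
Proof.
apply/measurable_fun_tnthP => j.
rewrite (_ : _ \o _ = fun w : Rd * Rd =>
    if j \in u then tnth w.1 j else tnth w.2 j); last first.
  by apply/funext => w /=; rewrite tnth_mktuple.
case: (j \in u).
  exact: (measurableT_comp (measurable_tnth j) measurable_fst).
exact: (measurableT_comp (measurable_tnth j) measurable_snd).
Qed.

Variable m : {sigma_finite_measure set (measurableTypeR R) -> \bar R}.
Hypothesis m1 : m setT = 1%E.
Local Notation Q := (tuple_measure m d).

(** The preimage of a box with sides A j is a product of two boxes: the side
    A j goes to the first point if j is in u and to the second one otherwise,
    and the other point has the whole line, of mass 1, as its side. *)
Lemma hybrid_measure_preserving u (X : set Rd) : measurable X ->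
  pushforward (Q \x Q)%E (fun w => hybrid u w.1 w.2) X = Q X.
Proof.
pose F : {mfun _ >-> _} := HB.pack (fun w : Rd * Rd => hybrid u w.1 w.2)
  (isMeasurableFun.Build _ _ _ _ _ (measurable_hybrid u)).
apply: (tuple_measure_unique (m' := pushforward (Q \x Q)%E F)) => // A mA.
pose B j := if j \in u then A j else setT.
pose C j := if j \in u then setT else A j.
have mB j : measurable (B j) by rewrite /B; case: ifP.
have mC j : measurable (C j) by rewrite /C; case: ifP.
rewrite /= /pushforward (_ : _ @^-1` _ =
    [set t | forall i, B i (tnth t i)] `*` [set t | forall i, C i (tnth t i)]).
  rewrite product_measure1E; [|exact: measurable_box..].
  transitivity ((\prod_(i < d) m (B i)) * (\prod_(i < d) m (C i)))%E.
    by congr (_ * _)%E; exact: tuple_measure_box.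
  rewrite -big_split; apply: eq_bigr => j _ /=; rewrite /B /C.
  by case: ifP => _; rewrite m1 ?mul1e ?mule1.
apply/seteqP; split => [[x z] /= Aw|[x z] [/= Bx Cz] j].
  split => j; have := Aw j; rewrite tnth_mktuple /B /C; case: ifP => //.
by have := Bx j; have := Cz j; rewrite tnth_mktuple /B /C; case: ifP.
Qed.

Lemma ge0_integral_hybrid u (h : Rd -> R) : measurable_fun setT h ->
  (forall x, 0 <= h x) ->
  (\int[Q]_x \int[Q]_z (h (hybrid u x z))%:E = \int[Q]_x (h x)%:E)%E.
Proof.
move=> mh h0.
have mEh : measurable_fun setT (EFin \o h) by exact/measurable_EFinP.
transitivity
  (\int[pushforward (Q \x Q)%E (fun w => hybrid u w.1 w.2)]_x (h x)%:E)%E.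
  rewrite ge0_integral_pushforward//; last 2 first.
  - exact: measurable_hybrid.
  - by move=> x _; rewrite lee_fin.
  rewrite preimage_setT fubini_tonelli1//.
  - exact: (measurableT_comp mEh (measurable_hybrid u)).
  - by move=> w; rewrite lee_fin.
apply: eq_measure_integral => [|mf X mX _]; first exact: measurable_hybrid.
exact: hybrid_measure_preserving.
Qed.

Lemma integrable_hybrid u (h : Rd -> R) : Q.-integrable setT (EFin \o h) ->
  (Q \x Q)%E.-integrable setT
    (EFin \o (fun w : Rd * Rd => h (hybrid u w.1 w.2))).
Proof.
move=> /integrableP[/measurable_EFinP mh hoo]; apply/integrable12ltyP.
  by apply/measurable_EFinP; exact: (measurableT_comp mh (measurable_hybrid u)).
rewrite (ge0_integral_hybrid u (h := fun x => `|h x|))//.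
exact: measurableT_comp.
Qed.

Lemma Rintegral_hybrid u (h : Rd -> R) : Q.-integrable setT (EFin \o h) ->
  \int[Q]_x \int[Q]_z h (hybrid u x z) = \int[Q]_x h x.
Proof.
move=> ih; have /integrableP[mEh _] := ih.
have ihu := integrable_hybrid u ih.
rewrite -(RintegralFubini ihu); congr fine.
transitivity
  (\int[pushforward (Q \x Q)%E (fun w => hybrid u w.1 w.2)]_x (h x)%:E)%E.
  rewrite integral_pushforward//; last exact: measurable_hybrid.
apply: eq_measure_integral => [|mf X mX _]; first exact: measurable_hybrid.
exact: hybrid_measure_preserving.
Qed.

End hybrid.

(** * Conditional means *)

Lemma measurable_Rintegral_section (d1 d2 : measure_display)
    (S : measurableType d1) (T : measurableType d2) (R : realType)
    (m : {sigma_finite_measure set T -> \bar R}) (H : S * T -> R) :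
  measurable_fun setT H ->
  measurable_fun setT (fun x => \int[m]_y H (x, y)).
Proof.
move=> mH; have mEH : measurable_fun setT (EFin \o H).
  exact/measurable_EFinP.
rewrite /Rintegral.
apply: (@measurableT_comp _ _ _ _ _ _ fine).
  exact: fine_measurable.
rewrite [X in measurable_fun _ X](_ : _ =
    fubini_F m (EFin \o H)^\+%E \- fubini_F m (EFin \o H)^\-%E)%E; last first.
  apply/funext => x; rewrite integralE /fubini_F.
  by congr (_ - _)%E; apply: eq_integral => y _; rewrite ?funeposE ?funenegE.
apply: emeasurable_funB; apply: measurable_fun_fubini_tonelli_F => //.
  exact: measurable_funepos.
exact: measurable_funeneg.
Qed.

Lemma normr_Rintegral_le (d : measure_display) (T : measurableType d)
    (R : realType) (m : {measure set T -> \bar R}) (h : T -> R) :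
  measurable_fun setT h ->
  (`|\int[m]_x h x|%:E <= \int[m]_x `|h x|%:E)%E.
Proof.
move=> mh.
have [ih|nih] := pselect (m.-integrable setT (EFin \o h)); last first.
  rewrite (Rintegral_not_integrable mh nih) normr0.
  by apply: integral_ge0 => x _; rewrite lee_fin.
rewrite EFin_normr_Rintegral//; apply: le_abse_integral => //.
exact/measurable_EFinP.
Qed.

Lemma lee_pexpe (R : realType) n (x y : \bar R) : (0 <= x)%E -> (x <= y)%E ->
  (x ^+ n <= y ^+ n)%E.
Proof.
move=> x0 xy; elim: n => // n IHn.
by rewrite !expeS lee_pmul// expe_ge0.
Qed.

Lemma emeasurable_funX (d : measure_display) (T : measurableType d)
    (R : realType) n (F : T -> \bar R) : measurable_fun setT F ->
  measurable_fun setT (fun x => (F x ^+ n)%E).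
Proof.
move=> mF; elim: n => [|n IHn]; first exact: measurable_cst.
by under eq_fun do rewrite expeS; exact: emeasurable_funM.
Qed.

Section slice_mean.
Context {R : realType} {d : nat}.
Local Notation Rd := (d.-tuple (measurableTypeR R)).
Implicit Types (u v : {set 'I_d}) (x : Rd).
Variable m : {sigma_finite_measure set (measurableTypeR R) -> \bar R}.
Hypothesis m1 : m setT = 1%E.
Local Notation Q := (tuple_measure m d).
Let Q1 : Q setT = 1%E. Proof. exact: tuple_measure_setT. Qed.
Variable g : Rd -> R.
Hypothesis mg : measurable_fun setT g.

(** The conditional mean of g(x) given the coordinates of x in u. *)
Definition slice_mean (u : {set 'I_d}) (x : Rd) : R :=
  \int[Q]_z g (hybrid u x z).

Lemma measurable_comp_hybrid u :
  measurable_fun setT (fun w : Rd * Rd => g (hybrid u w.1 w.2)).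
Proof. exact: (measurableT_comp mg (measurable_hybrid u)). Qed.

Lemma measurable_comp_hybrid2 u x :
  measurable_fun setT (fun z => g (hybrid u x z)).
Proof. exact: (measurable_fun_pair2 x (measurable_comp_hybrid u)). Qed.

Lemma measurable_slice_mean u : measurable_fun setT (slice_mean u).
Proof.
exact: (measurable_Rintegral_section Q (measurable_comp_hybrid u)).
Qed.

(** The tower property: split z into an independent pair by preservation of
    the measure, then reassociate the hybrid points. *)
Lemma slice_mean_tower u v x : u \subset v ->
  Q.-integrable setT (EFin \o (fun z => g (hybrid u x z))) ->
  slice_mean u x = \int[Q]_z slice_mean v (hybrid u x z).
Proof.
move=> uv ig; rewrite /slice_mean -(Rintegral_hybrid m1 v ig).
apply: eq_Rintegral => y _; apply: eq_Rintegral => z _.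
by rewrite hybridA.
Qed.

(** Conditional Jensen inequality.  It holds at every x: where the slice of g
    is not integrable, the left-hand side is 0. *)
Lemma normrX_slice_mean_le n u v x : u \subset v ->
  ((`|slice_mean u x| ^+ n.+1)%:E <=
   \int[Q]_z (`|slice_mean v (hybrid u x z)| ^+ n.+1)%:E)%E.
Proof.
move=> uv.
have mv : measurable_fun setT (fun z => slice_mean v (hybrid u x z)).
  apply: (measurableT_comp (measurable_slice_mean v)).
  exact: (measurable_fun_pair2 x (measurable_hybrid u)).
have [ig|nig] := pselect
    (Q.-integrable setT (EFin \o (fun z => g (hybrid u x z)))); last first.
  rewrite /slice_mean (Rintegral_not_integrable _ nig); last first.
    exact: measurable_comp_hybrid2.
  rewrite normr0 expr0n /=.
  by apply: integral_ge0 => z _; rewrite lee_fin exprn_ge0.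
rewrite (slice_mean_tower uv ig).
apply: le_trans (jensen_exprn n Q1
  (h := fun z => `|slice_mean v (hybrid u x z)|) _ _) => //.
  rewrite EFin_expe lee_pexpe// ?lee_fin//.
  exact: normr_Rintegral_le.
exact: measurableT_comp.
Qed.

Lemma integral_normrX_slice_mean_le n u v : u \subset v ->
  (\int[Q]_x (`|slice_mean u x| ^+ n.+1)%:E <=
   \int[Q]_x (`|slice_mean v x| ^+ n.+1)%:E)%E.
Proof.
move=> uv.
have mn w : measurable_fun setT (fun x => `|slice_mean w x| ^+ n.+1).
  apply: measurable_funX; apply: measurableT_comp => //.
  exact: measurable_slice_mean.
rewrite -(ge0_integral_hybrid m1 u (mn v)); last by move=> x; rewrite exprn_ge0.
apply: ge0_le_integral => //.
- exact/measurable_EFinP.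
- apply: (measurable_fun_fubini_tonelli_F
    (fun w : Rd * Rd => (`|slice_mean v (hybrid u w.1 w.2)| ^+ n.+1)%:E)).
    apply/measurable_EFinP.
    exact: (measurableT_comp (mn v) (measurable_hybrid u)).
  by move=> w; rewrite lee_fin exprn_ge0.
- by move=> x _; exact: normrX_slice_mean_le.
Qed.

(** Conditioning on all the coordinates changes nothing; hence the L^p bound on
    every [slice_mean] is an instance of [integral_normrX_slice_mean_le]. *)
Lemma slice_mean_setT x : slice_mean [set: 'I_d] x = g x.
Proof.
rewrite /slice_mean; under eq_Rintegral do rewrite hybrid_setT.
rewrite Rintegral_cst// -[RHS]mulr1; congr (_ * _).
exact: (congr1 fine Q1).
Qed.

(** Jensen's inequality in z for each x.  This bound is what makes the product
    of the replicas integrable. *)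
Lemma integral_abs_sectionX_le n u :
  (\int[Q]_x (\int[Q]_z `|g (hybrid u x z)|%:E) ^+ n.+1 <=
   \int[Q]_x (`|g x| ^+ n.+1)%:E)%E.
Proof.
have mabs : measurable_fun setT (fun w : Rd * Rd => `|g (hybrid u w.1 w.2)|).
  by apply: measurableT_comp => //; exact: measurable_comp_hybrid.
rewrite -(ge0_integral_hybrid m1 u (h := fun x => `|g x| ^+ n.+1));
  last 2 first.
- by apply: measurable_funX; exact: measurableT_comp.
- by move=> x; rewrite exprn_ge0.
apply: ge0_le_integral => //.
- by move=> x _; rewrite expe_ge0// integral_ge0// => z _; rewrite lee_fin.
- apply: emeasurable_funX; apply: (measurable_fun_fubini_tonelli_F
    (fun w : Rd * Rd => `|g (hybrid u w.1 w.2)|%:E)).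
    exact/measurable_EFinP.
  by move=> w; rewrite lee_fin.
- apply: (measurable_fun_fubini_tonelli_F
    (fun w : Rd * Rd => (`|g (hybrid u w.1 w.2)| ^+ n.+1)%:E)).
    by apply/measurable_EFinP; exact: measurable_funX.
  by move=> w; rewrite lee_fin exprn_ge0.
- move=> x _; apply: jensen_exprn => //.
  exact: (measurable_fun_pair2 x mabs).
Qed.

Lemma le_Rintegral_slice_meanX p u v : ~~ odd p -> (0 < p)%N -> u \subset v ->
  (\int[Q]_x (`|g x| ^+ p)%:E < +oo)%E ->
  \int[Q]_x slice_mean u x ^+ p <= \int[Q]_x slice_mean v x ^+ p.
Proof.
case: p => [//|n] ep _ uv goo.
have E w :
    \int[Q]_x slice_mean w x ^+ n.+1 = \int[Q]_x `|slice_mean w x| ^+ n.+1.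
  apply: eq_Rintegral => x _; rewrite -normrX ger0_norm//.
  exact: exprn_even_ge0.
have ge0 w : (0 <= \int[Q]_x (`|slice_mean w x| ^+ n.+1)%:E)%E.
  by apply: integral_ge0 => x _; rewrite lee_fin exprn_ge0.
have fin w : (\int[Q]_x (`|slice_mean w x| ^+ n.+1)%:E)%E \is a fin_num.
  rewrite ge0_fin_numE//; apply: le_lt_trans goo.
  under [leRHS]eq_integral do rewrite -slice_mean_setT.
  by apply: integral_normrX_slice_mean_le; exact: finset.subsetT.
rewrite !E; apply: fine_le; [exact: fin|exact: fin|].
exact: integral_normrX_slice_mean_le.
Qed.

End slice_mean.

(** * Restriction of product measures *)

Section restriction.
Local Open Scope ereal_scope.

(** A relation between two given measures, so that it applies to powers of
    measures, which are not built as restrictions. *)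
Definition is_restriction (d : measure_display) (T : measurableType d)
    (R : realType) (m' m : set T -> \bar R) (D : set T) :=
  forall A, measurable A -> m' A = m (A `&` D).

Lemma integral_restriction (d : measure_display) (T : measurableType d)
    (R : realType) (m' m : {measure set T -> \bar R}) (D : set T)
    (h : T -> \bar R) :
  measurable D -> is_restriction m' m D -> measurable_fun setT h ->
  \int[m]_(x in D) h x = \int[m']_x h x.
Proof.
move=> mD m'E mh; have mDC := measurableC mD.
have m'0 : m' (~` D) = 0 by rewrite m'E// setICl measure0.
have ge0 (k : T -> \bar R) : measurable_fun setT k -> (forall x, 0 <= k x) ->
    \int[m]_(x in D) k x = \int[m']_x k x.
  move=> mk k0; rewrite [RHS](ge0_negligible_integral mDC)// setTD setCK.
  apply: eq_measure_integral => A mA AD.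
  by rewrite m'E// setIidl.
rewrite integralE [RHS]integralE !ge0//.
  exact: measurable_funeneg.
exact: measurable_funepos.
Qed.

Lemma product_restriction (d1 d2 : measure_display) (T1 : measurableType d1)
    (T2 : measurableType d2) (R : realType)
    (m1 m1' : {sigma_finite_measure set T1 -> \bar R})
    (m2 m2' : {sigma_finite_measure set T2 -> \bar R}) D1 D2 :
  measurable D1 -> measurable D2 ->
  is_restriction m1' m1 D1 -> is_restriction m2' m2 D2 ->
  is_restriction (m1' \x m2') (m1 \x m2) (D1 `*` D2).
Proof.
move=> mD1 mD2 r1 r2 X mX; have mD := measurableX mD1 mD2.
apply: (product_measure_unique (m' := mrestr (m1 \x m2) mD)) => // A B mA mB.
by rewrite /= /mrestr -setXI product_measure1E ?r1 ?r2//; exact: measurableI.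
Qed.

Lemma tuple_restriction (d : measure_display) (T : measurableType d)
    (R : realType) (m m' : {sigma_finite_measure set T -> \bar R}) D n :
  measurable D -> is_restriction m' m D ->
  is_restriction (tuple_measure m' n) (tuple_measure m n)
    [set t | forall i, D (tnth t i)].
Proof.
move=> mD r; elim: n => [|n IHn] X mX.
  by rewrite (_ : mkset _ = setT) ?setIT//; apply/seteqP; split => // t _ [].
rewrite /= /tuple_measure_step /pushforward.
have mDn : measurable [set t : n.-tuple T | forall i, D (tnth t i)].
  exact: (measurable_box (fun=> mD)).
rewrite (product_restriction mD mDn r IHn); last first.
  by rewrite -[X in measurable X]setTI; exact: measurable_tuple_cons.
congr (_ _); rewrite preimage_setI; congr (_ `&` _).
apply/seteqP; split=> -[x t]/=.
  move=> [Dx Dt] i; case: (unliftP ord0 i) => [j ->|->//].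
  by rewrite tnthS.
move=> h; split=> [|i]; first exact: (h ord0).
by have := h (lift ord0 i); rewrite tnthS.
Qed.

End restriction.

(** * The unit cube *)

Section cube.
Context {R : realType} {d : nat}.
Local Notation Rd := (d.-tuple (measurableTypeR R)).

Definition unit_interval : set (measurableTypeR R) := [set x : R | 0 <= x <= 1].

Lemma unit_intervalE : unit_interval = `[0, 1]%classic.
Proof. by apply/seteqP; split => x /=; rewrite in_itv. Qed.

Lemma measurable_unit_interval : measurable unit_interval.
Proof. by rewrite unit_intervalE; exact: measurable_itv. Qed.

Lemma lebesgue_unit_interval : lebesgue_measure unit_interval = 1%E :> \bar R.
Proof.
by rewrite unit_intervalE lebesgue_measure_itv/= lte_fin ltr01 oppr0 adde0.
Qed.

Lemma lebesgue_unit_interval_lty :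
  (lebesgue_measure unit_interval < +oo :> \bar R)%E.
Proof. by rewrite lebesgue_unit_interval ltry. Qed.

Definition uniform01 : {finite_measure set (measurableTypeR R) -> \bar R} :=
  mfrestr measurable_unit_interval lebesgue_unit_interval_lty.

Lemma uniform01_setT : uniform01 setT = 1%E.
Proof. by rewrite /= /mfrestr /mrestr setTI lebesgue_unit_interval. Qed.

Lemma measurable_cube : measurable (cube d : set Rd).
Proof. exact: (measurable_box (fun=> measurable_unit_interval)). Qed.

Local Notation Q := (tuple_measure uniform01 d).

Lemma cube_restriction : is_restriction Q (lebesgue_tuple d) (cube d).
Proof. exact: (tuple_restriction measurable_unit_interval). Qed.

Lemma hybrid_cube (u : {set 'I_d}) (x z : Rd) :
  cube d x -> cube d z -> cube d (hybrid u x z).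
Proof. by move=> cx cz j; rewrite tnth_mktuple; case: ifP. Qed.

(** Since hybrids of points of the cube stay in the cube, f may be replaced by
    its extension by 0 and the domain of integration by the whole space with
    the restricted measures. *)
Lemma lower_tauE p (f : Rd -> R) (u : {set 'I_d}) : (0 < p)%N ->
  measurable_fun setT (f \_ (cube d)) ->
  (\int[Q]_x (`|(f \_ (cube d)) x| ^+ p)%:E < +oo)%E ->
  lower_tau p f u =
  \int[Q]_x slice_mean uniform01 (f \_ (cube d)) u x ^+ p - mean f ^+ p.
Proof.
set g := f \_ (cube d); move=> p0 mg goo; rewrite /lower_tau; congr (_ - _).
pose H (w : Rd * Rd) := g (hybrid u w.1 w.2).
have mH : measurable_fun setT H by exact: measurable_comp_hybrid.
transitivity (\int[(Q \x tuple_measure Q p)%E]_w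
    \prod_(k < p) H (w.1, tnth w.2 k)); last first.
  rewrite Rintegral_replicas//=.
  case: p p0 goo => // n _; apply: le_lt_trans.
  exact: (integral_abs_sectionX_le uniform01_setT mg).
have mcubes : measurable [set z : p.-tuple Rd | forall k, cube d (tnth z k)].
  exact: (measurable_box (fun=> measurable_cube)).
have mD := measurableX measurable_cube mcubes.
transitivity
  (\int[(lebesgue_tuple d \x tuple_measure (lebesgue_tuple d) p)%E]_(w in
    cube d `*` [set z : p.-tuple Rd | forall k, cube d (tnth z k)])
    \prod_(k < p) H (w.1, tnth w.2 k)).
  apply: eq_Rintegral => w; rewrite inE => -[/= cx cz].
  apply: eq_bigr => k _; rewrite /H/= /g patchE mem_set//.
  exact: hybrid_cube.
congr fine; apply: integral_restriction; first exact: mD.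
  apply: product_restriction; [exact: measurable_cube|exact: mcubes|..].
    exact: cube_restriction.
  by apply: tuple_restriction; [exact: measurable_cube|exact: cube_restriction].
by apply/measurable_EFinP; exact: measurable_replicas.
Qed.

End cube.

Unset Implicit Arguments.

(** * Monotonicity of the lower index *)

Theorem theorem1 (R : realType) (d : nat) (hd : (1 <= d)%N)
    (p : nat) (hp2 : (2 <= p)%N) (hp : ~~ odd p)
    (f : d.-tuple (measurableTypeR R) -> R)
    (hf : (f \_ (cube d) : _ -> R) \in Lfun (lebesgue_tuple d) p%:R%:E)
    (u v : {set 'I_d}) (huv : u \subset v) :
  lower_tau p f u <= lower_tau p f v.
Proof.
have p0 : (0 < p)%N by exact: leq_trans hp2.
have mg : measurable_fun setT (f \_ (cube d)).
  by move: hf; rewrite inE => /andP[/[!inE]].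
have goo : (\int[tuple_measure uniform01 d]_x
    (`|(f \_ (cube d)) x| ^+ p)%:E < +oo)%E.
  have mgp : measurable_fun setT (fun x => `|(f \_ (cube d)) x| ^+ p).
    by apply: measurable_funX; exact: measurableT_comp.
  have p1 : 1 <= p%:R :> R by rewrite ler1n.
  have /integrableP[_] := Lfun_integrable p1 hf.
  under eq_integral do rewrite /= powR_mulrn// ger0_norm ?exprn_ge0//.
  apply: le_lt_trans.
  rewrite -(integral_restriction measurable_cube cube_restriction); last first.
    exact/measurable_EFinP.
  apply: ge0_subset_integral => //; first exact: measurable_cube.
    exact/measurable_EFinP.
rewrite !(lower_tauE _ p0 mg goo) lerD2r.
exact: (le_Rintegral_slice_meanX uniform01_setT mg hp p0 huv goo).
Qed.
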